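(* Let $G=\mathrm{SL}_2(\mathbb{R})$. Any length function $l:G\to[0,+\infty)$ that is continuous on the subgroup $\mathrm{SO}(2)$ and on the diagonal subgroup is proportional to the translation function $\tau(g):=\inf_{x\in X}d(x,gx)$, where $X=\mathrm{SL}_2(\mathbb{R})/\mathrm{SO}(2)$ is the upper half-plane (that is, $l=c\,\tau$ for some constant $c\ge 0$).
   Context: A function $l:G\to[0,\infty)$ on a group $G$ is a length function if (1) $l(g^n)=|n|\,l(g)$ for all $g\in G$, $n\in\mathbb{Z}$; (2) $l(hgh^{-1})=l(g)$ for all $g,h\in G$; (3) $l(ab)\le l(a)+l(b)$ for all commuting elements $a,b\in G$. The upper half-plane $X$ carries the hyperbolic metric $d$, on which $\mathrm{SL}_2(\mathbb{R})$ acts isometrically by Möbius transformations. ''Continuous on a subgroup'' means that the restriction of $l$ to that subgroup is continuous. *)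

(* Defs.v *)
From HB Require Import structures.
From mathcomp Require Import all_boot all_order all_algebra.
From mathcomp Require Import all_classical all_reals all_analysis.
From mathcomp Require Import complex ring lra.
Set Implicit Arguments.
Unset Strict Implicit.
Unset Printing Implicit Defensive.
Import Order.TTheory GRing.Theory Num.Theory.
Import numFieldNormedType.Exports.
Local Open Scope classical_set_scope.
Local Open Scope ring_scope.
Local Open Scope complex_scope.

Definition expgz (G : groupType) (g : G) (n : int) : G :=
  match n with
  | Posz m => (g ^+ m)%g
  | Negz m => (g ^- m.+1)%g
  end.

Record length_function (R : realType) (G : groupType) (l : G -> R) : Prop := {
  length_ge0 : forall g, 0 <= l g;
  length_expgz : forall (g : G) (n : int), l (expgz g n) = `|n|%:~R * l g;
  length_conj : forall g h : G, l (h * g * h^-1)%g = l g;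
  length_commute : forall a b : G, commute a b -> l (a * b)%g <= l a + l b
}.

Record SL2 (R : realType) := MkSL2 {
  SL2val :> 'M[R]_2;
  SL2_det : \det SL2val == 1
}.

Section SL2Group.
Variable R : realType.

HB.instance Definition _ := [isSub for @SL2val R].
HB.instance Definition _ := [Choice of SL2 R by <:].

Lemma SL2_det1 (g : SL2 R) : \det (val g) = 1.
Proof. exact/eqP/SL2_det. Qed.

Lemma SL2_detE (g : SL2 R) :
  \det (val g) = val g 0 0 * val g 1 1 - val g 0 1 * val g 1 0.
Proof.
rewrite (expand_det_row _ 0) !big_ord_recl big_ord0 addr0 /cofactor !det_mx11 !mxE.
rewrite /= /bump /= expr0 expr1 mul1r mulN1r mulrN.
by congr (_ * val g _ _ - val g _ _ * val g _ _); apply: val_inj.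
Qed.

Lemma SL2_unitmx (g : SL2 R) : val g \in unitmx.
Proof. by rewrite unitmxE SL2_det1 unitr1. Qed.

Lemma SL2_one_subproof : \det (1%:M : 'M[R]_2) == 1.
Proof. by rewrite det1. Qed.

Lemma SL2_mul_subproof (g h : SL2 R) : \det (val g *m val h) == 1.
Proof. by rewrite det_mulmx !SL2_det1 mulr1. Qed.

Lemma SL2_inv_subproof (g : SL2 R) : \det (invmx (val g)) == 1.
Proof. by rewrite det_inv SL2_det1 invr1. Qed.

Definition SL2_one : SL2 R := MkSL2 SL2_one_subproof.
Definition SL2_mul (g h : SL2 R) : SL2 R := MkSL2 (SL2_mul_subproof g h).
Definition SL2_inv (g : SL2 R) : SL2 R := MkSL2 (SL2_inv_subproof g).

Lemma SL2_mulA : associative SL2_mul.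
Proof. by move=> g h k; apply: val_inj; rewrite /= mulmxA. Qed.

Lemma SL2_mul1 : left_id SL2_one SL2_mul.
Proof. by move=> g; apply: val_inj; rewrite /= mul1mx. Qed.

Lemma SL2_mul1r : right_id SL2_one SL2_mul.
Proof. by move=> g; apply: val_inj; rewrite /= mulmx1. Qed.

Lemma SL2_mulV : left_inverse SL2_one SL2_inv SL2_mul.
Proof. by move=> g; apply: val_inj; rewrite /= mulVmx ?SL2_unitmx. Qed.

Lemma SL2_mulVr : right_inverse SL2_one SL2_inv SL2_mul.
Proof. by move=> g; apply: val_inj; rewrite /= mulmxV ?SL2_unitmx. Qed.

HB.instance Definition _ :=
  isGroup.Build (SL2 R) SL2_mulA SL2_mul1 SL2_mul1r SL2_mulV SL2_mulVr.

HB.instance Definition _ :=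
  Topological.copy (SL2 R) (initial_topology (@SL2val R)).

Definition SO2 : set (SL2 R) :=
  [set g | (val g)^T *m val g = 1%:M].

Definition diagonal_subgroup : set (SL2 R) :=
  [set g | is_diag_mx (val g)].

End SL2Group.

Arguments SO2 R : clear implicits.
Arguments diagonal_subgroup R : clear implicits.

(* complex.Im is the R-valued imaginary part; the bare Im is R[i]-valued. *)
Record upper_half_plane (R : realType) := MkUHP {
  uhp_val :> R[i];
  uhp_gt0 : 0 < complex.Im uhp_val
}.

Section HyperbolicPlane.
Variable R : realType.
Local Notation X := (upper_half_plane R).

Definition moebius_num (g : SL2 R) (z : R[i]) : R[i] :=
  (val g 0 0)%:C * z + (val g 0 1)%:C.

Definition moebius_den (g : SL2 R) (z : R[i]) : R[i] :=
  (val g 1 0)%:C * z + (val g 1 1)%:C.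

Lemma moebius_subproof (g : SL2 R) (z : X) :
  0 < complex.Im (moebius_num g z / moebius_den g z).
Proof.
have := SL2_det1 g; rewrite SL2_detE /moebius_num /moebius_den.
set a := val g 0 0; set b := val g 0 1; set c := val g 1 0.
set d := val g 1 1 => dt.
case: z => [[x y]] /= y0.
have n0 : 0 < (c * x + d) ^+ 2 + (c * y) ^+ 2.
  have [c0|c0] := eqVneq c 0.
    have d0 : d != 0 by apply/eqP => d0; move: dt; rewrite c0 d0; lra.
    by rewrite c0 !mul0r add0r expr0n addr0 exprn_even_gt0.
  by rewrite ltr_wpDl ?sqr_ge0 // exprn_even_gt0 //= mulf_neq0 // gt_eqF.
rewrite !mul0r ?addr0 ?subr0 ?add0r.
rewrite [X in 0 < X](_ : _ = (a * d - b * c) * y /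
    ((c * x + d) ^+ 2 + (c * y) ^+ 2)); first by rewrite dt mul1r divr_gt0.
by field; rewrite gt_eqF.
Qed.

Definition moebius (g : SL2 R) (z : X) : X := MkUHP (moebius_subproof g z).

Definition arcosh (t : R) : R := ln (t + Num.sqrt (t ^+ 2 - 1)).

(* The distance of the metric (dx^2 + dy^2) / y^2, of curvature -1. *)
Definition hyperbolic_dist (z w : X) : R :=
  arcosh (1 + Normc.normc (uhp_val z - uhp_val w) ^+ 2
              / (2 * complex.Im (uhp_val z) * complex.Im (uhp_val w))).

Definition translation_function (g : SL2 R) : R :=
  inf (range (fun x : X => hyperbolic_dist x (moebius g x))).

End HyperbolicPlane.

(* Main.v *)
Require Import Defs.
From mathcomp Require Import all_boot all_order all_algebra.
From mathcomp Require Import all_classical all_reals all_analysis.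
From mathcomp Require Import complex ring lra.
Import Order.TTheory GRing.Theory Num.Theory.
Import numFieldNormedType.Exports.
Set Implicit Arguments.
Unset Strict Implicit.
Unset Printing Implicit Defensive.
Local Open Scope classical_set_scope.
Local Open Scope ring_scope.

(** Both sides of the claimed identity are class functions on SL_2(R), and every
    element is conjugate to a rotation, to an upper triangular matrix with equal
    diagonal entries, or to a diagonal matrix, according to whether the square
    of its trace is less than, equal to or greater than 4.  So it suffices to
    compare l and tau on these three kinds of matrices ([eq_class_function]).

    The length l.  Along a continuous one-parameter subgroup p, homogeneity
    gives l (p q) = |q| l (p 1) for q rational, hence for q real by continuity
    ([length_one_parameter]).  On SO(2) the period 2 pi forces l (p 1) = 0, so l
    vanishes there.  On a parabolic matrix l vanishes because its square is
    a unipotent matrix u, and u is conjugate to u^4, so that l u = 4 l u.  On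
    a diagonal matrix with entries a and 1/a, squaring lands in the
    one-parameter group of matrices diag (e^t, e^-t), which gives
    l = c |ln a^2| with 2 c = l (diag (e, 1/e)).

    The translation function tau.  Moebius maps are isometries, so tau is
    a class function.  Writing g z = n / d, the distance from z to g z is
    arcosh (1 + |z d - n|^2 / (2 (Im z)^2)) ([displacement]).  A rotation fixes
    i; a parabolic z -> z + b moves i y by a distance that tends to 0 when y
    grows; and z -> a^2 z moves each point by at least |ln a^2|, with equality
    on the imaginary axis.  Hence tau is 0, 0 and |ln a^2| on the three normal
    forms, and l = c tau. *)

(** * Length functions along one-parameter subgroups *)

Lemma eq_continuous_rat (R : realType) (f g : R -> R) :
  continuous f -> continuous g ->
  (forall q : rat, f (ratr q) = g (ratr q)) -> forall t, f t = g t.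
Proof.
move=> cf cg fg t; apply/eqP/negPn/negP => fgt.
have cfg : continuous (fun x => f x - g x).
  by move=> x; apply: cvgB; [exact: cf|exact: cg].
have /= [] := @dense_rat R ((fun x => f x - g x) @^-1` [set y | y != 0]).
- by exists t; rewrite /= subr_eq0.
- apply: open_comp; last exact: open_neq.
  by move=> x _; exact: cfg.
- by move=> s [/= + [q _ qs]]; rewrite -qs fg subrr eqxx.
Qed.

Lemma expgz_one_parameter (R : realType) (G : groupType) (p : R -> G) :
  {morph p : s t / s + t >-> (s * t)%g} ->
  forall n t, expgz (p t) n = p (n%:~R * t).
Proof.
move=> pD.
have p0 : p 0 = 1%g by apply: (mulgI (p 0)); rewrite -pD addr0 mulg1.
have pX n t : (p t ^+ n)%g = p (n%:R * t).
  elim: n => [|n IHn]; first by rewrite mul0r p0 expg0.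
  by rewrite expgSr IHn -pD -natr1 mulrDl mul1r.
case=> n t /=; first by rewrite pX.
rewrite pX; apply: (mulgI (p (n.+1%:R * t))).
by rewrite mulgV -pD NegzE mulrNz mulNr subrr p0.
Qed.

(** Homogeneity alone gives the formula at rational parameters, since
    p (m / n) ^ n = p 1 ^ m; continuity extends it to all real ones. *)
Lemma length_one_parameter (R : realType) (G : groupType) (l : G -> R)
    (p : R -> G) :
  length_function l -> {morph p : s t / s + t >-> (s * t)%g} ->
  continuous (l \o p) -> forall t, l (p t) = `|t| * l (p 1).
Proof.
move=> ll pD cp.
have hom (n : int) t : l (p (n%:~R * t)) = `|n%:~R| * l (p t).
  by rewrite -expgz_one_parameter// length_expgz// intr_norm.
apply: (@eq_continuous_rat _ (l \o p) (fun t => `|t| * l (p 1))) => //.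
  by move=> t; apply: cvgM; [exact: norm_continuous|exact: cvg_cst].
move=> q /=.
have d0 : (denq q)%:~R != 0 :> R by rewrite intr_eq0 denq_neq0.
have qE : ratr q = (numq q)%:~R / (denq q)%:~R :> R by [].
apply: (mulfI (_ : `|(denq q)%:~R| != 0 :> R)); first by rewrite normr_eq0.
rewrite -hom qE mulrCA divff// mulr1 mulrA -normrM mulrCA divff// mulr1.
by rewrite -[X in p X]mulr1 hom.
Qed.

Lemma length1 (R : realType) (G : groupType) (l : G -> R) :
  length_function l -> l 1%g = 0.
Proof. by move=> ll; have := length_expgz ll 1%g 0; rewrite /= expg0 mul0r. Qed.

Lemma lengthX (R : realType) (G : groupType) (l : G -> R) g n :
  length_function l -> l (g ^+ n)%g = n%:R * l g.
Proof. by move=> ll; have := length_expgz ll g n. Qed.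

(** * Matrices of determinant one *)

Section SL2Matrices.
Variable R : realType.
Implicit Types g h k : SL2 R.

Lemma ord2P (P : 'I_2 -> Prop) : P 0 -> P 1 -> forall i, P i.
Proof.
move=> P0 P1 [[|[|//]]] i;
  [rewrite (_ : Ordinal i = 0)|rewrite (_ : Ordinal i = 1)] => //;
  exact: val_inj.
Qed.

Lemma sl2_ext g h :
  val g 0 0 = val h 0 0 -> val g 0 1 = val h 0 1 ->
  val g 1 0 = val h 1 0 -> val g 1 1 = val h 1 1 -> g = h.
Proof.
move=> e00 e01 e10 e11; apply: val_inj; apply/matrixP.
by apply: ord2P; apply: ord2P.
Qed.

Lemma sl2_mulE g h i j :
  val (g * h)%g i j = val g i 0 * val h 0 j + val g i 1 * val h 1 j.
Proof.
rewrite /= mxE big_ord_recl big_ord1 (_ : lift _ _ = 1)//.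
exact: val_inj.
Qed.

Lemma sl2_oneE i j : val (1%g : SL2 R) i j = (i == j)%:R.
Proof. by rewrite /= mxE. Qed.

Definition mx2 (a b c d : R) : 'M[R]_2 :=
  \matrix_(i, j) if i == 0 then if j == 0 then a else b
                 else if j == 0 then c else d.

Lemma det_mx2 a b c d : a * d - b * c = 1 -> \det (mx2 a b c d) == 1.
Proof.
move=> <-; apply/eqP.
rewrite (expand_det_row _ 0) !big_ord_recl big_ord0 addr0 /cofactor.
by rewrite !det_mx11 !mxE /= /bump /= expr0 expr1 mul1r mulN1r mulrN.
Qed.

Definition sl2 a b c d (abcd : a * d - b * c = 1) : SL2 R :=
  MkSL2 (det_mx2 abcd).

Lemma sl2E a b c d (abcd : a * d - b * c = 1) :
  (val (sl2 abcd) 0 0 = a) * (val (sl2 abcd) 0 1 = b) *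
  (val (sl2 abcd) 1 0 = c) * (val (sl2 abcd) 1 1 = d).
Proof. by rewrite /= !mxE. Qed.

Lemma sl2_SO2 a c (ac : a * a - - c * c = 1) : SO2 R (sl2 ac).
Proof.
apply/matrixP; apply: ord2P; apply: ord2P;
  rewrite !mxE big_ord_recl big_ord1 !mxE /= ?mulrNN; [|ring|ring|];
  by rewrite -ac; ring.
Qed.

Lemma conj_sl2 g h k : (h * g = k * h)%g -> k = (h * g * h^-1)%g.
Proof. by move=> ->; rewrite mulgK. Qed.

Lemma continuous_sl2 (p : R -> SL2 R) :
  (forall i j, continuous (fun t => val (p t) i j)) -> continuous p.
Proof.
move=> cp; apply/continuous_comp_initial => t A [P PM sPA].
have Pp i j : \forall s \near t, P i j (val (p s) i j) by exact: cp (PM i j).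
have Ppi i : \forall s \near t, forall j, P i j (val (p s) i j).
  exact: (filter_forall (nbhs_filter t) (Pp i)).
rewrite nbhs_filterE /=.
by apply: (filterS _ (filter_forall (nbhs_filter t) Ppi)) => s Ps; exact: sPA.
Qed.

Lemma continuous_within_comp (l : SL2 R -> R) (A : set (SL2 R))
    (p : R -> SL2 R) :
  {within A, continuous l} -> continuous p -> (forall t, A (p t)) ->
  continuous (l \o p).
Proof.
move=> /subspace_continuousP lA cp Ap t U Ul.
have lU : \forall s \near t, A (p s) -> U (l (p s)).
  exact: cp (lA _ (Ap t) U Ul).
rewrite nbhs_filterE /=.
by apply: (filterS _ lU) => s /(_ (Ap s)).
Qed.

End SL2Matrices.

(** * Rotations and dilations as one-parameter subgroups *)

Section OneParameterSubgroups.
Variable R : realType.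
Implicit Types (g : SL2 R) (s t : R).

Lemma rot_subproof (t : R) : cos t * cos t - - sin t * sin t = 1.
Proof. by rewrite mulNr opprK -!expr2 cos2Dsin2. Qed.

Definition rot t : SL2 R := sl2 (rot_subproof t).

Lemma rotD : {morph rot : s t / s + t >-> (s * t)%g}.
Proof.
by move=> s t; apply: sl2_ext; rewrite sl2_mulE !sl2E ?cosD ?sinD; ring.
Qed.

Lemma rot_SO2 t : SO2 R (rot t).
Proof. exact: sl2_SO2. Qed.

Lemma SO2E g : SO2 R g -> val g 1 1 = val g 0 0 /\ val g 0 1 = - val g 1 0.
Proof.
move=> /matrixP gg; have := SL2_det1 g; rewrite SL2_detE.
have := gg 0 0; have := gg 1 1.
rewrite !mxE !big_ord_recl !big_ord0 !mxE /= (_ : lift 0 0 = 1); last exact: val_inj.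
set a := val g 0 0; set b := val g 0 1; set c := val g 1 0; set d := val g 1 1.
rewrite !addr0 => bd ac dt.
have : (d - a) ^+ 2 + (b + c) ^+ 2 = 0.
  transitivity ((a * a + c * c) + (b * b + d * d) - 2 * (a * d - b * c)).
    by ring.
  by rewrite bd ac dt; ring.
move/eqP; rewrite paddr_eq0 ?sqr_ge0// !sqrf_eq0 subr_eq0 addr_eq0.
by move=> /andP[/eqP -> /eqP ->].
Qed.

Lemma SO2_rot g : SO2 R g -> exists t, g = rot t.
Proof.
move=> /SO2E[da bc]; have := SL2_det1 g; rewrite SL2_detE da bc.
set a := val g 0 0; set c := val g 1 0 => ac.
have ac1 : a ^+ 2 + c ^+ 2 = 1 by rewrite -ac; ring.
have a1 : -1 <= a <= 1.
  rewrite -ler_norml -[X in _ <= X]normr1 -ler_sqr ?nnegrE//.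
  by rewrite !real_normK ?num_real// expr1n -ac1 lerDl sqr_ge0.
have sa : sin (acos a) = `|c|.
  by rewrite sin_acos// -ac1 addrC addKr sqrtr_sqr.
have ca : cos (acos a) = a by apply: acosK; rewrite in_itv.
have [c0|c0] := leP 0 c.
  exists (acos a); apply: sl2_ext; rewrite sl2E ?ca ?sa ?ger0_norm//.
exists (- acos a); apply: sl2_ext; rewrite sl2E ?cosN ?sinN ?ca ?sa ?ltr0_norm ?opprK//.
Qed.

Lemma continuous_rot : continuous rot.
Proof.
apply: continuous_sl2; apply: ord2P; apply: ord2P => x;
  under eq_fun do rewrite sl2E.
- exact: continuous_cos.
- by apply: cvgN; exact: continuous_sin.
- exact: continuous_sin.
- exact: continuous_cos.
Qed.

Lemma dil_subproof (t : R) : expR t * expR (- t) - 0 * 0 = 1.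
Proof. by rewrite -expRD subrr expR0; ring. Qed.

Definition dil t : SL2 R := sl2 (dil_subproof t).

Lemma dilD : {morph dil : s t / s + t >-> (s * t)%g}.
Proof.
move=> s t; apply: sl2_ext; rewrite sl2_mulE !sl2E ?opprD ?expRD; ring.
Qed.

Lemma dil_diagonal t : diagonal_subgroup R (dil t).
Proof.
apply/is_diag_mxP; apply: ord2P; apply: ord2P => //= _; by rewrite !mxE.
Qed.

Lemma continuous_dil : continuous dil.
Proof.
apply: continuous_sl2; apply: ord2P; apply: ord2P => x;
  under eq_fun do rewrite sl2E.
- exact: continuous_expR.
- exact: cvg_cst.
- exact: cvg_cst.
- by apply: continuous_comp; [exact: opp_continuous|exact: continuous_expR].
Qed.

End OneParameterSubgroups.

(** * The length function on the normal forms *)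

(** The full turn is trivial while having length 2 pi l (rot 1). *)
Lemma length_SO2 (R : realType) (l : SL2 R -> R) : length_function l ->
  {within SO2 R, continuous l} ->
  forall g, SO2 R g -> l g = 0.
Proof.
move=> ll lc g /SO2_rot[t ->].
have hom := length_one_parameter ll (@rotD R)
  (continuous_within_comp lc (@continuous_rot R) (@rot_SO2 R)).
have r2pi : rot (pi *+ 2) = 1%g :> SL2 R.
  by apply: sl2_ext; rewrite sl2E sl2_oneE ?cos2pi ?sin2pi ?oppr0.
have := hom (pi *+ 2); rewrite r2pi (length1 ll) => /esym/eqP.
rewrite mulf_eq0 normr_eq0 mulrn_eq0 /= gt_eqF ?pi_gt0//= => /eqP l1.
by rewrite hom l1 mulr0.
Qed.

(** Conjugation by diag (2, 1/2) multiplies the off-diagonal entry by 4, as does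
    the fourth power; hence l g = 4 l g. *)
Lemma length_unipotent (R : realType) (l : SL2 R -> R) (g : SL2 R) :
  length_function l -> val g 0 0 = 1 -> val g 1 1 = 1 -> val g 1 0 = 0 -> l g = 0.
Proof.
move=> ll a1 d1 c0.
have half : 2 * 2^-1 - 0 * 0 = 1 :> R by field.
pose h : SL2 R := sl2 half.
have g4 : (g ^+ 4)%g = (h * g * h^-1)%g.
  apply: conj_sl2; rewrite !expgS expg0 mulg1.
  by apply: sl2_ext; rewrite !sl2_mulE !sl2E a1 d1 c0; field.
have := lengthX g 4 ll; rewrite g4 length_conj//; lra.
Qed.

(** The diagonal entries are both 1 or both -1; squaring removes the sign. *)
Lemma length_parabolic (R : realType) (l : SL2 R -> R) (g : SL2 R) :
  length_function l -> val g 1 0 = 0 -> val g 0 0 = val g 1 1 -> l g = 0.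
Proof.
move=> ll c0 ad; have := SL2_det1 g; rewrite SL2_detE c0 mulr0 subr0 -ad => a2.
have := lengthX g 2 ll; rewrite expgS expg1 length_unipotent//; first lra.
- by rewrite sl2_mulE c0 mulr0 addr0.
- by rewrite sl2_mulE c0 mul0r add0r -ad.
- by rewrite sl2_mulE c0; ring.
Qed.

(** The square of g has positive entries, so it is a dilation even when the
    entries of g are negative. *)
Lemma length_diag (R : realType) (l : SL2 R -> R) : length_function l ->
  {within diagonal_subgroup R, continuous l} ->
  forall g : SL2 R, val g 0 1 = 0 -> val g 1 0 = 0 ->
  l g = l (dil 1) / 2 * `|ln (val g 0 0 ^+ 2)|.
Proof.
move=> ll lc g b0 c0; have := SL2_det1 g; rewrite SL2_detE b0 c0 mulr0 subr0 => ad.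
have hom := length_one_parameter ll (@dilD R)
  (continuous_within_comp lc (@continuous_dil R) (@dil_diagonal R)).
have a0 : val g 0 0 != 0.
  by apply/eqP => a0; move/eqP: ad; rewrite a0 mul0r eq_sym oner_eq0.
have a2 : 0 < val g 0 0 ^+ 2 by rewrite exprn_even_gt0.
have g2 : (g ^+ 2)%g = dil (ln (val g 0 0 ^+ 2)).
  rewrite expgS expg1; apply: sl2_ext; rewrite sl2_mulE sl2E ?b0 ?c0 ?expRN ?lnK ?posrE//.
  - by rewrite mul0r addr0.
  - by ring.
  - by ring.
  - rewrite mul0r add0r; have -> : val g 1 1 = (val g 0 0)^-1.
      by apply: (mulfI a0); rewrite ad divff.
    by rewrite -expr2 exprVn.
have := lengthX g 2 ll; rewrite g2 hom => E.
by apply: (mulfI (_ : 2%:R != 0 :> R)); rewrite ?pnatr_eq0// -E; field.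
Qed.

(** * Conjugation to a normal form *)

Section NormalForm.
Variable R : realType.
Implicit Types g h k : SL2 R.

(** Such a g fixes the point x + i r^2 of the upper half-plane, where
    x = (a - d) / (2 c) and r^2 = sqrt (4 - tr^2) / (2 |c|) solve
    c z^2 + (d - a) z - b = 0.  The conjugator moves this point to i, whose
    stabiliser is SO(2). *)
Lemma conj_elliptic g : (val g 0 0 + val g 1 1) ^+ 2 < 4 ->
  exists h, SO2 R (h * g * h^-1)%g.
Proof.
have := SL2_det1 g; rewrite SL2_detE.
set a := val g 0 0; set b := val g 0 1; set c := val g 1 0; set d := val g 1 1.
move=> dt tr.
have c0 : c != 0.
  apply/eqP => c0; move: dt; rewrite c0 mulr0 subr0 => ad.
  have := sqr_ge0 (a - d); move: tr; nra.
pose r := Num.sqrt (Num.sqrt (4 - (a + d) ^+ 2) / (2 * `|c|)).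
have tr0 : 0 < 4 - (a + d) ^+ 2 by rewrite subr_gt0.
have r0 : 0 < r by rewrite sqrtr_gt0 divr_gt0 ?sqrtr_gt0 ?mulr_gt0 ?normr_gt0.
have r4 : 4 * c ^+ 2 * r ^+ 4 = 4 - (a + d) ^+ 2.
  rewrite (exprM r 2 2) sqr_sqrtr; last first.
    by rewrite divr_ge0 ?sqrtr_ge0 ?mulr_ge0.
  rewrite expr_div_n sqr_sqrtr ?ltW// exprMn real_normK ?num_real//.
  by field.
have rn0 : r != 0 by rewrite gt_eqF.
have hP : r^-1 * r - (- ((a - d) / (2 * c)) / r) * 0 = 1 by field; rewrite ?rn0 ?c0.
have kP : (a + d) / 2 * ((a + d) / 2) - - (c * r ^+ 2) * (c * r ^+ 2) = 1.
  rewrite [LHS](_ : _ = (4 * c ^+ 2 * r ^+ 4 + (a + d) ^+ 2) / 4); last by field.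
  by rewrite r4; field.
exists (sl2 hP); rewrite -(@conj_sl2 _ g _ (sl2 kP)); last first.
  apply: sl2_ext; rewrite !sl2_mulE !sl2E -/a -/b -/c -/d.
  - by field; rewrite ?rn0 ?c0.
  - apply/eqP; rewrite -subr_eq0; apply/eqP.
    rewrite [LHS](_ : _ = (4 * (b * c - a * d + 1) +
      (4 * c ^+ 2 * r ^+ 4 - (4 - (a + d) ^+ 2))) / (4 * c * r)).
      rewrite r4 subrr addr0 (_ : b * c - a * d + 1 = 0) ?mulr0 ?mul0r//.
      by lra.
    by field; rewrite ?rn0 ?c0.
  - by field; rewrite ?rn0 ?c0.
  - by field; rewrite ?rn0 ?c0.
exact: sl2_SO2.
Qed.

(** When the lower left entry c is not 0, the discriminant tr^2 - 4 of
    c x^2 + (d - a) x - b is nonnegative, so g fixes a point x of the real line;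
    the conjugator sends x to infinity. *)
Lemma conj_triangular g : 4 <= (val g 0 0 + val g 1 1) ^+ 2 ->
  exists h, val (h * g * h^-1)%g 1 0 = 0.
Proof.
have := SL2_det1 g; rewrite SL2_detE.
set a := val g 0 0; set b := val g 0 1; set c := val g 1 0; set d := val g 1 1.
move=> dt tr.
have [c0|c0] := eqVneq c 0.
  by exists 1%g; rewrite mul1g invg1 mulg1.
pose D := Num.sqrt ((a + d) ^+ 2 - 4); pose x := (a - d + D) / (2 * c).
have D2 : D ^+ 2 = (a + d) ^+ 2 - 4 by rewrite sqr_sqrtr// subr_ge0.
have xP : b - x * d = - (a - c * x) * x.
  apply/eqP; rewrite -subr_eq0; apply/eqP.
  rewrite [LHS](_ : _ = (4 * (1 - (a * d - b * c)) +
    ((a + d) ^+ 2 - 4 - D ^+ 2)) / (4 * c)).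
    by rewrite D2 dt; field.
  by rewrite /x; field.
have hP : 0 * - x - - 1 * 1 = 1 :> R by ring.
have kP : (d + c * x) * (a - c * x) - - c * 0 = 1.
  by rewrite -dt; rewrite (_ : b = x * d - (a - c * x) * x); [ring|move: xP; lra].
exists (sl2 hP); rewrite -(@conj_sl2 _ g _ (sl2 kP)) ?sl2E//.
apply: sl2_ext; rewrite !sl2_mulE !sl2E -/a -/b -/c -/d; try ring.
by rewrite mul1r mulNr [x * d]mulrC in xP *; move: xP; nra.
Qed.

(** The conjugator translates the real fixed point b / (d - a) of g to 0. *)
Lemma conj_diag g : val g 1 0 = 0 -> val g 0 0 != val g 1 1 ->
  exists h, val (h * g * h^-1)%g 0 1 = 0 /\ val (h * g * h^-1)%g 1 0 = 0.
Proof.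
have := SL2_det1 g; rewrite SL2_detE.
set a := val g 0 0; set b := val g 0 1; set c := val g 1 0; set d := val g 1 1.
move=> dt c0; rewrite -subr_eq0 => ad.
have hP : 1 * 1 - b / (a - d) * 0 = 1 by ring.
have kP : a * d - 0 * 0 = 1 by rewrite -dt c0; ring.
exists (sl2 hP); rewrite -(@conj_sl2 _ g _ (sl2 kP)) ?sl2E//.
by apply: sl2_ext; rewrite !sl2_mulE !sl2E -/a -/b -/c -/d ?c0; field.
Qed.

Lemma eq_class_function (f1 f2 : SL2 R -> R) :
  (forall g h, f1 (h * g * h^-1)%g = f1 g) ->
  (forall g h, f2 (h * g * h^-1)%g = f2 g) ->
  (forall g, SO2 R g -> f1 g = f2 g) ->
  (forall g, val g 1 0 = 0 -> val g 0 0 = val g 1 1 -> f1 g = f2 g) ->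
  (forall g, val g 0 1 = 0 -> val g 1 0 = 0 -> f1 g = f2 g) ->
  forall g, f1 g = f2 g.
Proof.
move=> f1J f2J fS fP fD g.
have [tr|/conj_elliptic[h /fS]] := leP 4 ((val g 0 0 + val g 1 1) ^+ 2); last first.
  by rewrite f1J f2J.
have [h] := conj_triangular tr.
rewrite -(f1J g h) -(f2J g h); move: (h * g * h^-1)%g => {tr h}g c0.
have [|/conj_diag] := eqVneq (val g 0 0) (val g 1 1); first exact: fP.
by move=> /(_ c0)[h [b0 {}c0]]; rewrite -(f1J g h) -(f2J g h); exact: fD.
Qed.

End NormalForm.

(** * The translation function *)

Section Translation.
Variable R : realType.
Local Notation X := (upper_half_plane R).
Implicit Types (g h : SL2 R) (z w : X).

Lemma uhp_inj z w : uhp_val z = uhp_val w -> z = w.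
Proof.
case: z w => [z z0] [w w0] /= zw; subst w.
by congr MkUHP; exact: eq_irrelevance.
Qed.

Lemma moebius_den_neq0 g z : moebius_den g z != 0.
Proof.
have := SL2_det1 g; rewrite SL2_detE /moebius_den.
set a := val g 0 0; set b := val g 0 1; set c := val g 1 0; set d := val g 1 1.
case: z => [[x y] /= y0] dt; apply/eqP => -[].
rewrite !mul0r !addr0 subr0 => cd /eqP.
rewrite mulf_eq0 (gt_eqF y0) orbF => /eqP c0.
by move: dt cd; rewrite c0; nra.
Qed.

Lemma normc_moebius_den_neq0 g z : Normc.normc (moebius_den g z) != 0.
Proof.
by apply/eqP => /Normc.eq0_normc/eqP; rewrite (negbTE (moebius_den_neq0 g z)).
Qed.

Lemma normc_sqr (x y : R) : Normc.normc (Complex x y) ^+ 2 = x ^+ 2 + y ^+ 2.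
Proof. by rewrite /Normc.normc sqr_sqrtr// addr_ge0 ?sqr_ge0. Qed.

Lemma Im_moebius g z :
  complex.Im (uhp_val (moebius g z)) =
  complex.Im (uhp_val z) / Normc.normc (moebius_den g z) ^+ 2.
Proof.
have := normc_moebius_den_neq0 g z; rewrite -sqrf_eq0.
have := SL2_det1 g; rewrite SL2_detE /= /moebius_num /moebius_den.
set a := val g 0 0; set b := val g 0 1; set c := val g 1 0; set d := val g 1 1.
case: z => [[x y] /= y0] dt.
rewrite /= normc_sqr !mul0r ?addr0 ?subr0 ?add0r => n0.
transitivity ((a * d - b * c) * y / ((c * x + d) ^+ 2 + (c * y) ^+ 2)).
  by field.
by rewrite dt mul1r.
Qed.

Lemma moebiusM g h z : moebius (g * h)%g z = moebius g (moebius h z).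
Proof.
apply: uhp_inj => /=.
have := moebius_den_neq0 (g * h)%g z; have := moebius_den_neq0 h z.
rewrite /moebius_num /moebius_den !sl2_mulE !rmorphD !rmorphM /= => dh dgh.
field; rewrite dh /=; apply: contra_neq dgh => E; rewrite -[RHS]E; ring.
Qed.

Lemma moebius1 z : moebius 1%g z = z.
Proof.
apply: uhp_inj; rewrite /= /moebius_num /moebius_den !mxE /=.
by rewrite rmorph0 rmorph1 mul1r mul0r addr0 add0r divr1.
Qed.

Lemma moebius_sub g z w :
  uhp_val (moebius g z) - uhp_val (moebius g w) =
  (uhp_val z - uhp_val w) / (moebius_den g z * moebius_den g w).
Proof.
have := moebius_den_neq0 g z; have := moebius_den_neq0 g w.
have := SL2_det1 g; rewrite SL2_detE => /(congr1 (fun x => x%:C%C)).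
rewrite rmorphB !rmorphM rmorph1 /= /moebius_num /moebius_den => dt dz dw.
rewrite -[uhp_val z - uhp_val w in RHS]mul1r -[1 in RHS]dt; field; exact/andP.
Qed.

(** The factors |c z + d| coming from the difference and from the imaginary
    parts cancel. *)
Lemma hyperbolic_dist_moebius g z w :
  hyperbolic_dist (moebius g z) (moebius g w) = hyperbolic_dist z w.
Proof.
rewrite /hyperbolic_dist moebius_sub !Im_moebius Normc.normcM Normc.normcV Normc.normcM.
have nz := normc_moebius_den_neq0 g.
have y0 u : complex.Im (uhp_val u) != 0 by rewrite gt_eqF// uhp_gt0.
congr (arcosh (1 + _)); field; rewrite ?nz ?y0//.
Qed.

Lemma translation_function_conj g h :
  translation_function (h * g * h^-1)%g = translation_function g.
Proof.
rewrite /translation_function; congr inf; apply/seteqP; split=> _ [z _ <-].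
  exists (moebius h^-1%g z) => //.
  by rewrite -(hyperbolic_dist_moebius h) -!moebiusM mulgV moebius1.
exists (moebius h z) => //.
by rewrite -moebiusM -mulgA mulVg mulg1 moebiusM hyperbolic_dist_moebius.
Qed.

(** Since Im (g z) = Im z / |d|^2 and z - n / d = (z d - n) / d for g z = n / d,
    the modulus of d drops out of the distance. *)
Lemma displacement g z :
  hyperbolic_dist z (moebius g z) =
  arcosh (1 + Normc.normc (uhp_val z * moebius_den g z - moebius_num g z) ^+ 2
              / (2 * complex.Im (uhp_val z) ^+ 2)).
Proof.
have dn := moebius_den_neq0 g z.
have n0 := normc_moebius_den_neq0 g z.
have y0 : complex.Im (uhp_val z) != 0 by rewrite gt_eqF// uhp_gt0.
rewrite /hyperbolic_dist Im_moebius /=.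
have -> : uhp_val z - moebius_num g z / moebius_den g z =
    (uhp_val z * moebius_den g z - moebius_num g z) / moebius_den g z by field.
rewrite Normc.normcM Normc.normcV.
by congr (arcosh (1 + _)); field; rewrite n0 y0.
Qed.

Lemma arcosh1 : arcosh 1 = 0 :> R.
Proof. by rewrite /arcosh expr1n subrr sqrtr0 addr0 ln1. Qed.

Lemma ler_arcosh (s t : R) : 1 <= s -> s <= t -> arcosh s <= arcosh t.
Proof.
move=> s1 st; have s0 := lt_le_trans ltr01 s1.
have t0 := lt_le_trans s0 st.
rewrite /arcosh ler_ln ?posrE; last 2 first.
- by rewrite ltr_pwDl// sqrtr_ge0.
- by rewrite ltr_pwDl// sqrtr_ge0.
by rewrite lerD// ler_wsqrtr// lerB// ler_sqr// nnegrE ltW.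
Qed.

Lemma arcosh_ge0 (t : R) : 1 <= t -> 0 <= arcosh t.
Proof. by move=> t1; rewrite -arcosh1 ler_arcosh. Qed.

Lemma arcosh_cosh (t : R) : arcosh ((expR t + expR (- t)) / 2) = `|t|.
Proof.
wlog t0 : t / 0 <= t => [H|].
  by have [/H//|/ltW t0] := leP 0 t; rewrite -normrN -H ?oppr_ge0// opprK addrC.
have e0 := expR_gt0 t; have n0 : expR t != 0 by rewrite gt_eqF.
rewrite /arcosh ger0_norm// expRN.
have -> : ((expR t + (expR t)^-1) / 2) ^+ 2 - 1 = ((expR t - (expR t)^-1) / 2) ^+ 2.
  by field.
rewrite sqrtr_sqr ger0_norm; last first.
  by rewrite divr_ge0// subr_ge0 -expRN ler_expR ge0_cp.
by rewrite -[RHS]expRK; congr ln; field.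
Qed.

Lemma hyperbolic_dist_ge0 z w : 0 <= hyperbolic_dist z w.
Proof.
apply: arcosh_ge0; rewrite lerDl divr_ge0// ?sqr_ge0//.
by rewrite !mulr_ge0// ltW// uhp_gt0.
Qed.

Lemma translation_function_le g z :
  translation_function g <= hyperbolic_dist z (moebius g z).
Proof.
apply: ge_inf; last by exists z.
by exists 0 => _ [w _ <-]; exact: hyperbolic_dist_ge0.
Qed.

Lemma imaginary_subproof (y : R) : 0 < y -> 0 < complex.Im (Complex 0 y).
Proof. by []. Qed.

Definition imaginary y (y0 : 0 < y) : X := MkUHP (imaginary_subproof y0).

Lemma le_translation_function g m :
  (forall z, m <= hyperbolic_dist z (moebius g z)) -> m <= translation_function g.
Proof.
move=> mz; apply: lb_le_inf; last by move=> _ [w _ <-].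
pose i := imaginary ltr01.
by exists (hyperbolic_dist i (moebius g i)); exists i.
Qed.

Lemma translation_function_ge0 g : 0 <= translation_function g.
Proof. by apply: le_translation_function => z; exact: hyperbolic_dist_ge0. Qed.

Lemma translation_function_SO2 g : SO2 R g -> translation_function g = 0.
Proof.
move=> /SO2E[da bc]; apply/eqP; rewrite eq_le translation_function_ge0 andbT.
rewrite (le_trans (translation_function_le g (imaginary ltr01)))//.
rewrite displacement /moebius_num /moebius_den da bc.
rewrite [X in Normc.normc X](_ : _ = 0).
  by rewrite Normc.normc0 expr0n mul0r addr0 arcosh1.
apply/eqP; rewrite eq_complex /= !mul0r !mul1r !mulr0.
by apply/andP; split; apply/eqP; ring.
Qed.

(** The infimum is not attained in general: the displacement of i y tends to 0
    as y grows. *)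
Lemma translation_function_parabolic g :
  val g 1 0 = 0 -> val g 0 0 = val g 1 1 -> translation_function g = 0.
Proof.
move=> c0 ad; apply/eqP; rewrite eq_le translation_function_ge0 andbT.
apply/ler_addgt0Pl => e e0; rewrite addr0.
(* With m = 2 sinh (e / 2), cosh e = 1 + m^2 / 2 while i y is displaced by
   arcosh (1 + b^2 / (2 y^2)); any y >= |b| / m works, and adding 1 to |b| keeps
   y positive when b = 0. *)
pose q := expR (e / 2); pose m := q - q^-1.
have q0 : 0 < q by exact: expR_gt0.
have m0 : 0 < m.
  by rewrite subr_gt0 (@lt_trans _ _ 1) ?invf_lt1// ?expR_gt1 ?divr_gt0.
pose b := val g 0 1.
have b1 : 0 < `|b| + 1 by rewrite ltr_wpDl.
have y0 : 0 < (`|b| + 1) / m by rewrite divr_gt0.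
apply: (le_trans (translation_function_le g (imaginary y0))).
rewrite displacement /moebius_num /moebius_den c0 -ad.
rewrite [X in Normc.normc X](_ : _ = Complex (- b) 0); last first.
  by apply/eqP; rewrite eq_complex /= -/b; apply/andP; split; apply/eqP; ring.
rewrite normc_sqr /= -[leRHS]gtr0_norm// -(arcosh_cosh e); apply: ler_arcosh.
  rewrite lerDl; apply: divr_ge0; first exact: addr_ge0 (sqr_ge0 _) (sqr_ge0 _).
  exact: mulr_ge0 (ler0n _ _) (sqr_ge0 _).
have -> : (expR e + expR (- e)) / 2 = 1 + m ^+ 2 / 2.
  have -> : e = e / 2 + e / 2 by field.
  rewrite opprD !expRD -/q expRN -/q /m; field.
  by rewrite gt_eqF.
rewrite lerD2l.
have -> : ((- b) ^+ 2 + 0 ^+ 2) / (2 * ((`|b| + 1) / m) ^+ 2) =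
    (m ^+ 2 / 2) * (b / (`|b| + 1)) ^+ 2.
  by field; rewrite !gt_eqF.
rewrite ler_piMr ?divr_ge0 ?sqr_ge0//.
rewrite -[X in X <= _]real_normK ?num_real// exprn_ile1// normrM normfV.
by rewrite (gtr0_norm b1) ler_pdivrMr// mul1r lerDl.
Qed.

(** The displacement of x + i y increases with |x / y|, so it is least on the
    imaginary axis, the axis of g. *)
Lemma translation_function_diag g :
  val g 0 1 = 0 -> val g 1 0 = 0 ->
  translation_function g = `|ln (val g 0 0 ^+ 2)|.
Proof.
move=> b0 c0; have := SL2_det1 g; rewrite SL2_detE b0 c0 mulr0 subr0.
set a := val g 0 0; set d := val g 1 1 => ad.
have a0 : a != 0.
  by apply/eqP => a0; move/eqP: ad; rewrite a0 mul0r eq_sym oner_eq0.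
have a2 : 0 < a ^+ 2 by rewrite exprn_even_gt0.
have dE : d = a^-1 by apply: (mulfI a0); rewrite ad divff.
have chE : 1 + (d - a) ^+ 2 / 2 = (expR (ln (a ^+ 2)) + expR (- ln (a ^+ 2))) / 2.
  by rewrite expRN lnK ?posrE// dE; field.
have distE z : hyperbolic_dist z (moebius g z) =
  arcosh (1 + (d - a) ^+ 2 / 2 *
    (1 + (complex.Re (uhp_val z) / complex.Im (uhp_val z)) ^+ 2)).
  rewrite displacement /moebius_num /moebius_den b0 c0 -/a -/d.
  case: z => [[x y] y0]; have yn0 : y != 0 by rewrite gt_eqF.
  rewrite [X in Normc.normc X](_ : _ = Complex ((d - a) * x) ((d - a) * y)); last first.
    by apply/eqP; rewrite eq_complex /=; apply/andP; split; apply/eqP; ring.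
  by rewrite normc_sqr /=; congr (arcosh (1 + _)); field.
apply/eqP; rewrite eq_le; apply/andP; split.
  apply: (le_trans (translation_function_le g (imaginary ltr01))).
  by rewrite distE /= mul0r expr0n addr0 mulr1 chE arcosh_cosh.
apply: le_translation_function => z; rewrite distE -(arcosh_cosh (ln (a ^+ 2))) -chE.
apply: ler_arcosh; first by rewrite lerDl divr_ge0 ?sqr_ge0.
by rewrite lerD2l ler_peMr ?divr_ge0 ?sqr_ge0// lerDl sqr_ge0.
Qed.

End Translation.

Theorem theorem0p3 (R : realType) (l : SL2 R -> R)
    (l_length : length_function l)
    (l_cont_SO2 : {within SO2 R, continuous l})
    (l_cont_diag : {within diagonal_subgroup R, continuous l}) :
  exists c : R, 0 <= c /\ forall g : SL2 R, l g = c * translation_function g.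
Proof.
exists (l (dil 1) / 2); split; first by rewrite divr_ge0// length_ge0.
apply: eq_class_function => g.
- by move=> h; exact: length_conj.
- by move=> h; rewrite translation_function_conj.
- move=> gS; rewrite translation_function_SO2// mulr0; exact: length_SO2 gS.
- move=> c0 ad; rewrite translation_function_parabolic// mulr0.
  exact: length_parabolic.
- by move=> b0 c0; rewrite translation_function_diag//; exact: length_diag.
Qed.
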